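(* Let $d$ be the dimension, $D=\binom{d+1}{2}$, let $G=(V,E)$ be a graph with a multiset $R$ of vertices of $V$, and let $p^\circ:R\to\mathbb{R}^d$. Then there exists $b:E\to Gr(2,\mathbb{R}^{d+1})$ such that the $d$-dimensional pinned body-bar framework $(G,R;b,p^\circ)$ is infinitesimally rigid if and only if $$|\delta_G(\mathcal{P})|\ \ge\ D|\mathcal{P}|-\sum_{X\in\mathcal{P},\,R_X\ne\emptyset}\ \sum_{i=1}^{d_X+1}(d-i+1)$$ for every partition $\mathcal{P}$ of the vertex set $V$ (into non-empty subsets), where $d_X$ denotes the dimension of the affine span of $p^\circ(R_X)$.
   Context: Graphs are finite and undirected. The multiset $R$ is an indexed family of vertices (elements with different indices are different elements of $R$); $R_v=\{r\in R\mid r=v\}$ for $v\in V$ and $R_X=\{r\in R\mid r\in X\}$ for $X\subseteq V$. For a partition $\mathcal{P}$ of $V$, $|\mathcal{P}|$ is the number of parts and $\delta_G(\mathcal{P})$ is the set of edges of $G$ connecting two distinct parts. $Gr(2,\mathbb{R}^{d+1})$ is the Grassmannian of $2$-dimensional linear subspaces, identified via the Plücker embedding with the set of classes $[v_1\wedge v_2]\in\mathbb{P}(\bigwedge^2\mathbb{R}^{d+1})$ of nonzero decomposable elements; $b_e$ denotes a representative vector in $\bigwedge^2\mathbb{R}^{d+1}$ of $b(e)$. For $a\in\bigwedge^{d-1}\mathbb{R}^{d+1}$ and $c\in\bigwedge^2\mathbb{R}^{d+1}$, $\langle a,c\rangle$ denotes the standard Euclidean inner product $\langle a,*c\rangle$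 of $a$ with the Hodge dual of $c$. A $d$-dimensional pinned body-bar framework is a tuple $(G,R;b,p^\circ)$ with $b:E\to Gr(2,\mathbb{R}^{d+1})$, $e\mapsto[b_e]$, and $p^\circ:R\to\mathbb{R}^d$ (the body of $v$ is pinned at $p^\circ(r)$ for each $r\in R_v$). An infinitesimal motion is a map $m:V\to\bigwedge^{d-1}\mathbb{R}^{d+1}$ with $\langle m(u)-m(v),b_e\rangle=0$ for all $e=uv\in E$, and, for all $v\in V$ and $r\in R_v$, $\langle m(v),(p^\circ(r),1)\wedge(q,1)\rangle=0$ for every $q\in\mathbb{R}^d$. The framework is infinitesimally rigid if it has no nonzero infinitesimal motion. *)

(* Defs.v *)
From HB Require Import structures.
From mathcomp Require Import all_boot all_order all_algebra.
From mathcomp Require Import reals.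

Set Implicit Arguments.
Unset Strict Implicit.
Unset Printing Implicit Defensive.

Import Order.TTheory GRing.Theory Num.Theory.
Local Open Scope ring_scope.

(* The exterior power /\^k R^n, in coordinates with respect to the basis
   e_A = e_(a_1) /\ ... /\ e_(a_k), A = {a_1 < ... < a_k} a k-subset of 'I_n. *)
Definition ext (R : realType) (n k : nat) :=
  {ffun {A : {set 'I_n} | #|A| == k} -> R}.

Definition ext_coord (R : realType) (n k : nat) (c : ext R n k)
    (A : {set 'I_n}) : R :=
  if insub A is Some A' then c A' else 0.

(* The coordinate of v /\ w at {i < j} is v_i w_j - v_j w_i; for each A the sum
   has exactly one term. *)
Definition wedge (R : realType) (n : nat) (v w : 'rV[R]_n) : ext R n 2 :=
  [ffun A => \sum_(ij : 'I_n * 'I_n |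
                     (ij.1 < ij.2)%N && (val A == [set ij.1; ij.2]))
     (v 0 ij.1 * w 0 ij.2 - v 0 ij.2 * w 0 ij.1)].

(* The sign in e_A /\ e_(~: A) = (-1)^(inversions A) e_0 /\ ... /\ e_(n-1). *)
Definition inversions (n : nat) (A : {set 'I_n}) : nat :=
  #|[set ij : 'I_n * 'I_n | [&& ij.1 \in A, ij.2 \notin A & (ij.2 < ij.1)%N]]|.

(* *e_A = (-1)^(inversions A) e_(~: A), extended linearly. *)
Definition hodge (R : realType) (n k : nat) (c : ext R n k) :
    ext R n (n - k) :=
  [ffun B => (-1) ^+ inversions (~: val B) * ext_coord c (~: val B)].

Definition inner (R : realType) (n k : nat) (a c : ext R n k) : R :=
  \sum_A a A * c A.

(* <a, c> = <a, *c>; the degree n - 2 of *c is convertible to d - 1 when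
   n = d.+1. *)
Definition pairing (R : realType) (d : nat) (a : ext R d.+1 (d - 1))
    (c : ext R d.+1 2) : R :=
  inner a (hodge c).

Definition Gr2 (R : realType) (n : nat) :=
  {U : {vspace 'rV[R]_n} | \dim U == 2%N}.

(* c is a representative vector of the image of U under the Pluecker embedding;
   as the basis of U is arbitrary, c ranges over the whole class minus 0. *)
Definition represents (R : realType) (n : nat) (c : ext R n 2) (U : Gr2 R n) :=
  exists v w : 'rV[R]_n, val U = <<[:: v; w]>>%VS /\ c = wedge v w.

(* (p, 1) in R^(d+1). *)
Definition homog (R : realType) (d : nat) (p : 'rV[R]_d) : 'rV[R]_d.+1 :=
  \row_(i < d.+1) oapp (p 0) 1 (unlift ord_max i).

(* A finite undirected graph on V is given by a finite type E of edges and the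
   two ends of each edge: parallel edges and loops are allowed. The order in
   which the ends of an edge are listed is immaterial: reversing an edge changes
   neither crossing_edges nor inf_motion. A multiset of vertices is given by a
   finite index type I and rt : I -> V, so that R_v is the set of r : I with
   rt r = v. *)

Definition crossing_edges (V E : finType) (ends : E -> V * V)
    (P : {set {set V}}) : {set E} :=
  [set e | pblock P (ends e).1 != pblock P (ends e).2].

Definition roots_in (V I : finType) (rt : I -> V) (X : {set V}) : {set I} :=
  [set r | rt r \in X].

Definition inf_motion (R : realType) (d : nat) (V E I : finType)
    (ends : E -> V * V) (rt : I -> V) (b : E -> Gr2 R d.+1)
    (p : I -> 'rV[R]_d) (m : V -> ext R d.+1 (d - 1)) : Prop :=
  (forall (e : E) (c : ext R d.+1 2), represents c (b e) ->
     pairing (m (ends e).1 - m (ends e).2) c = 0) /\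
  (forall (v : V) (r : I), rt r = v -> forall q : 'rV[R]_d,
     pairing (m v) (wedge (homog (p r)) (homog q)) = 0).

Definition inf_rigid (R : realType) (d : nat) (V E I : finType)
    (ends : E -> V * V) (rt : I -> V) (b : E -> Gr2 R d.+1)
    (p : I -> 'rV[R]_d) : Prop :=
  forall m : V -> ext R d.+1 (d - 1),
    inf_motion ends rt b p m -> forall v : V, m v = 0.

Definition aff_span (R : realType) (d : nat) (I : finType)
    (p : I -> 'rV[R]_d) (S : {set I}) (x : 'rV[R]_d) : Prop :=
  exists a : I -> R, \sum_(r in S) a r = 1 /\ x = \sum_(r in S) a r *: p r.

(* The dimension of an affine subspace is that of its direction; see
   aff_spanP. *)
Definition aff_dir (R : realType) (d : nat) (I : finType)
    (p : I -> 'rV[R]_d) (S : {set I}) : {vspace 'rV[R]_d} :=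
  <<[seq p r - p s | r <- enum S, s <- enum S]>>%VS.

Definition aff_dim (R : realType) (d : nat) (I : finType)
    (p : I -> 'rV[R]_d) (S : {set I}) : nat :=
  \dim (aff_dir p S).

Lemma aff_spanP (R : realType) (d : nat) (I : finType)
    (p : I -> 'rV[R]_d) (S : {set I}) (r0 : I) (x : 'rV[R]_d) :
  r0 \in S -> aff_span p S x <-> x - p r0 \in aff_dir p S.
Proof.
move=> r0S; split=> [[a [a1 ->]]|].
  rewrite -[p r0]scale1r -a1 scaler_suml -sumrB rpred_sum // => r rS.
  rewrite -scalerBr rpredZ // memv_span //.
  by apply/allpairsP; exists (r, r0); rewrite !mem_enum.
pose X := [seq p r - p s | r <- enum S, s <- enum S].
rewrite -[aff_dir p S]/(<<in_tuple X>>%VS) => /coord_span xE.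
suff [f [f0 fE]] : exists f : I -> R,
    \sum_(r in S) f r = 0 /\ x - p r0 = \sum_(r in S) f r *: p r.
  exists (fun r => f r + (r == r0)%:R); split.
    rewrite big_split /= f0 add0r (bigD1 r0) //= eqxx big1 ?addr0 // => r.
    by case/andP=> _ /negPf->.
  under eq_bigr do rewrite scalerDl.
  rewrite big_split /= -fE [X in _ + X](bigD1 r0) //= eqxx scale1r big1.
    by rewrite addr0 subrK.
  by move=> r /andP[_ /negPf->]; rewrite scale0r.
rewrite {}xE; apply: (big_ind (fun y => exists f : I -> R,
    \sum_(r in S) f r = 0 /\ y = \sum_(r in S) f r *: p r)).
- by exists (fun=> 0); split; rewrite big1 // => r _; rewrite scale0r.
- move=> _ _ [f [f0 ->]] [g [g0 ->]]; exists (fun r => f r + g r); split.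
    by rewrite big_split /= f0 g0 addr0.
  by rewrite -big_split; apply: eq_bigr => r _; rewrite scalerDl.
move=> i _; move: (coord _ _ _) => c.
have /allpairsP[[r s] /= []] : (in_tuple X)`_i \in X by rewrite mem_nth.
rewrite !mem_enum => rS sS ->.
exists (fun t => c * ((t == r)%:R - (t == s)%:R)).
have pick1 t : t \in S -> \sum_(u in S) (u == t)%:R = 1 :> R.
  move=> tS; rewrite (bigD1 t) //= eqxx big1 ?addr0 // => u.
  by case/andP=> _ /negPf->.
have pickp t : t \in S -> \sum_(u in S) (u == t)%:R *: p u = p t.
  move=> tS; rewrite (bigD1 t) //= eqxx scale1r big1 ?addr0 // => u.
  by case/andP=> _ /negPf->; rewrite scale0r.
split; first by rewrite -mulr_sumr sumrB !pick1 // subrr mulr0.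
under eq_bigr do rewrite -scalerA scalerBl.
by rewrite -scaler_sumr sumrB !pickp.
Qed.

(* Main.v *)
(* An infinitesimal motion is a point of the space of pinned maps m, and a bar e
   with representative c imposes one linear equation on it.  The pinned maps that
   are constant on the parts of P form a space whose dimension is the right-hand
   side of the inequality: the twists pinned at the points p r, r in S, are
   annihilated by y /\ z for all z and all y in the span of the vectors
   (p r, 1), so they form a space of dimension C(d + 1 - (d_S + 1), 2).  Only
   crossing edges constrain such maps, which gives necessity.  For sufficiency
   the bars are chosen among the e_i /\ e_j: by Rado's theorem a good choice
   exists as soon as, for every J, imposing all e_i /\ e_j at the edges of J leaves
   a space of dimension at most the number of edges outside J, and this is the
   hypothesis for the partition into connected components of J. *)
Require Import Defs.
From HB Require Import structures.
From mathcomp Require Import all_boot all_order all_algebra.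
From mathcomp Require Import reals.
From mathcomp Require Import zify ring.

Set Implicit Arguments.
Unset Strict Implicit.
Unset Printing Implicit Defensive.

Import Order.TTheory GRing.Theory Num.Theory.
Local Open Scope ring_scope.

(** * Subspaces cut out by hyperplanes, and a dual form of Rado's theorem *)

Section Subspaces.
Variables (K : fieldType) (vT : vectType K).
Implicit Types U V M : {vspace vT}.

Lemma memv_bigcapP (I : finType) (P : pred I) (Us : I -> {vspace vT}) v :
  reflect (forall i, P i -> v \in Us i) (v \in \bigcap_(i | P i) Us i)%VS.
Proof. by rewrite memvE; apply: (iffP subv_bigcapP) => h i /h; rewrite memvE. Qed.

Lemma dim_fullv_ffun (I : finType) :
  \dim (fullv : {vspace {ffun I -> K^o}}) = #|I|.
Proof. by rewrite dimvf; apply: muln1. Qed.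

(** By rank-nullity each linear form lowers the dimension by at most one. *)
Lemma dim_cap_bigcap_lker (E : finType) (S : {set E})
    (phi : E -> 'Hom(vT, K^o)) U :
  (\dim U <= \dim (U :&: \bigcap_(e in S) lker (phi e)) + #|S|)%N.
Proof.
have [n] := ubnP #|S|; elim: n S => // n IHn S.
have [->|[e eS]] := set_0Vmem S; first by rewrite big_set0 capvf cards0 addn0.
rewrite (cardsD1 e) eS /= ltnS => /[dup] ltSn /IHn h.
rewrite (bigD1 e) //= (eq_bigl (fun i => i \in S :\ e)); last first.
  by move=> i; rewrite !inE andbC.
move: (\bigcap_(_ in _) _)%VS h => B h.
rewrite [(lker _ :&: _)%VS]capvC capvA.
apply: leq_trans h _; rewrite addnA leq_add2r -(limg_ker_dim (phi e)) leq_add2l.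
by apply: leq_trans (dimvS (subvf _)) _; rewrite dimvf.
Qed.

(* The dual form of Rado's theorem on independent transversals: if moreover
   every H e i is a hyperplane, i.e. a vector of the dual of M, then the f e form
   a spanning transversal. *)
Theorem rado_spanning_transversal (E I : finType) (H : E -> I -> {vspace vT})
    M (T : E -> {set I}) :
  (forall e, T e != set0) ->
  (forall J : {set E},
     (\dim (M :&: \bigcap_(e in J) \bigcap_(i in T e) H e i) <= #|~: J|)%N) ->
  exists f : E -> I,
    (forall e, f e \in T e) /\ (M :&: \bigcap_e H e (f e) = 0)%VS.
Proof.
pose C (T : E -> {set I}) (J : {set E}) :=
  (M :&: \bigcap_(e in J) \bigcap_(i in T e) H e i)%VS.
have CP (T' : E -> {set I}) (J : {set E}) v : reflect
    (v \in M /\ forall e i, e \in J -> i \in T' e -> v \in H e i) (v \in C T' J).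
  rewrite memv_cap; apply: (iffP andP) => -[vM h]; split=> //.
    by move=> e i eJ iT; move/memv_bigcapP: h => /(_ _ eJ)/memv_bigcapP; apply.
  by apply/memv_bigcapP => e eJ; apply/memv_bigcapP => i; apply: h.
(* Induction on the total number of candidates: if some [T e0] has two of them, [x] and [y], one can
   be deleted without violating the condition. *)
have [n] := ubnP (\sum_e #|T e|); elim: n T => // n IHn T ltTn T0 condT.
have [/forallP T1|] := boolP [forall e, #|T e| <= 1]%N.
  have /fin_all_exists[f fE] e : exists i, T e = [set i].
    by apply/cards1P; rewrite eqn_leq T1 card_gt0 T0.
  exists f; split=> [e|]; first by rewrite fE set11.
  (* With a single candidate for each [e], the condition for J = [setT] is the claim. *)
  apply/eqP; rewrite -dimv_eq0 -leqn0; move: (condT setT).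
  rewrite setCT cards0; apply: leq_trans; apply: dimvS.
  apply/subvP=> v; rewrite memv_cap => /andP[vM /memv_bigcapP vH].
  by apply/CP; split=> // e i _; rewrite fE => /set1P->; apply: vH.
rewrite negb_forall => /existsP[e0]; rewrite -ltnNge.
case/card_gt1P=> x [y [xT yT xy]].
pose D z e := if e == e0 then T e :\ z else T e.
have DT z e : D z e \subset T e.
  by rewrite /D; case: eqP => // _; rewrite subD1set.
have IHD z z' : z \in T e0 -> z' \in T e0 -> z' != z ->
    [forall J, (\dim (C (D z) J) <= #|~: J|)%N] -> exists f : E -> I,
    (forall e, f e \in T e) /\ (M :&: \bigcap_e H e (f e) = 0)%VS.
  move=> zT z'T z'z /forallP condD; have [||//|f [fD fE]] := IHn (D z).
  - rewrite -ltnS; apply: leq_trans ltTn; rewrite ltnS (bigD1 e0) //=.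
    rewrite [X in (_ < X)%N](bigD1 e0) //= /D eqxx (cardsD1 z (T e0)) zT.
    by rewrite ltnS leq_add2l; apply: leq_sum => e _; apply/subset_leq_card/DT.
  - move=> e; rewrite /D; case: (e =P e0) => [->|//].
    by apply/set0Pn; exists z'; rewrite !inE z'z.
  by exists f; split=> // e; apply: subsetP (DT z e) _ (fD e).
have [/IHD|] := boolP [forall J, (\dim (C (D x) J) <= #|~: J|)%N].
  by apply=> //; last by rewrite eq_sym; exact: xy.
have [/IHD h _|] := boolP [forall J, (\dim (C (D y) J) <= #|~: J|)%N].
  exact: (h x).
(* Otherwise deleting [x] violates the condition at some [J1], and deleting [y] at some [J2]. Both
   sets contain [e0], the only place where a deletion is felt. *)
rewrite !negb_forall => /existsP[J2 +] /existsP[J1].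
have in_e0 z J : ~~ (\dim (C (D z) J) <= #|~: J|)%N -> e0 \in J.
  apply: contraNT => e0J; apply: leq_trans (condT J); apply: dimvS.
  apply/subvP=> v /CP[vM vH]; apply/CP; split=> // e i eJ iT; apply: vH => //.
  by rewrite /D; case: eqP eJ e0J => // -> ->.
move=> /[dup] /in_e0 e0J2 + /[dup] /in_e0 e0J1; rewrite -!ltnNge => gt2 gt1.
(* Submodularity gives the contradiction. The two dimensions add up to at least |~J1| + |~J2| + 2.
   The intersection satisfies all constraints on J1 U J2, as every candidate at [e0] survives one of
   the deletions; the sum satisfies those on the common part of J1 and J2 without [e0], which costs
   only 1. *)
have := dimv_sum_cap (C (D x) J1) (C (D y) J2).
have : (\dim (C (D x) J1 :&: C (D y) J2) <= #|~: (J1 :|: J2)|)%N.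
  apply: leq_trans (condT _); apply: dimvS; apply/subvP=> v.
  rewrite memv_cap => /andP[/CP[vM v1] /CP[_ v2]]; apply/CP; split=> // e i eJ iT.
  have [ee|ne] := eqVneq e e0.
    have [ix|nx] := eqVneq i x.
      by apply: v2; rewrite ?ee // /D eqxx !inE ix xy -ix -ee.
    by apply: v1; rewrite ?ee // /D eqxx !inE nx -ee.
  by case/setUP: eJ => eJ; [apply: v1 | apply: v2]; rewrite // /D (negPf ne).
have : (\dim (C (D x) J1 + C (D y) J2) <= #|~: (J1 :&: J2)| + 1)%N.
  have : (\dim (C (D x) J1 + C (D y) J2) <= #|~: ((J1 :&: J2) :\ e0)|)%N.
    apply: leq_trans (condT _); apply: dimvS; apply/subvP=> v.
    case/memv_addP=> v1 /CP[v1M v1H] [v2 /CP[v2M v2H] ->].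
    apply/CP; split=> [|e i]; first exact: memvD.
    by rewrite !inE => /and3P[ne e1 e2] iT; apply: memvD; [apply: v1H | apply: v2H];
      rewrite // /D (negPf ne).
  move/leq_trans; apply.
  by rewrite setCD; apply: leq_trans (leq_card_setU _ _).1 _; rewrite cards1.
move: gt1 gt2; have := cardsUI (~: J1) (~: J2); rewrite -setCI -setCU; lia.
Qed.
End Subspaces.

(** * The pairing with wedge products, and the annihilator of a subspace *)

Section Wedge.
Variables (R : realType) (d : nat).
(** Coefficients in [R^o] instead of [R] give [ext R d.+1 (d - 1)] its vector space structure. *)
Local Notation W := {ffun {A : {set 'I_d.+1} | #|A| == (d - 1)%N} -> R^o}.
Implicit Types (a : W) (v w x y z : 'rV[R]_d.+1) (Y : {vspace 'rV[R]_d.+1}).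

Lemma ext_coord_wedge v w A :
  ext_coord (wedge v w) A =
    \sum_(ij : 'I_d.+1 * 'I_d.+1 | (ij.1 < ij.2)%N && (A == [set ij.1; ij.2]))
      (v 0 ij.1 * w 0 ij.2 - v 0 ij.2 * w 0 ij.1).
Proof.
rewrite /ext_coord; case: insubP => [A' _ <-|]; first by rewrite ffunE.
move=> A2; rewrite big_pred0 // => ij; apply: contraNF A2 => /andP[lt_ij /eqP->].
by rewrite cards2 neq_ltn lt_ij.
Qed.

Lemma pairing_wedgeE a v w :
  pairing a (wedge v w) = \sum_B \sum_(ij : 'I_d.+1 * 'I_d.+1 |
      (ij.1 < ij.2)%N && (~: val B == [set ij.1; ij.2]))
    a B * (-1) ^+ inversions (~: val B) *
      (v 0 ij.1 * w 0 ij.2 - v 0 ij.2 * w 0 ij.1).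
Proof.
apply: eq_bigr => B _; rewrite ffunE ext_coord_wedge mulrA.
by rewrite big_distrr.
Qed.

Definition pairing_form (c : ext R d.+1 2) (a : W) : R^o := pairing a c.

Fact pairing_form_linear c : linear (pairing_form c).
Proof.
move=> k a b; rewrite /pairing_form /pairing /inner scaler_sumr -big_split /=.
by apply: eq_bigr => B _; rewrite !ffunE mulrDl /GRing.scale /= mulrA.
Qed.

HB.instance Definition _ c :=
  GRing.isLinear.Build R W R^o _ (pairing_form c) (pairing_form_linear c).

Definition wedge_form a w v : R^o := pairing a (wedge v w).

Fact wedge_form_linear a w : linear (wedge_form a w).
Proof.
move=> k v v'; rewrite /wedge_form !pairing_wedgeE scaler_sumr -big_split.
apply: eq_bigr => B _; rewrite scaler_sumr -big_split; apply: eq_bigr => ij _ /=.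
by rewrite !mxE /GRing.scale /=; ring.
Qed.

Lemma pairing_wedgeC a v w : pairing a (wedge w v) = - pairing a (wedge v w).
Proof.
rewrite !pairing_wedgeE -sumrN; apply: eq_bigr => B _.
by rewrite -sumrN; apply: eq_bigr => ij _; ring.
Qed.

Lemma pairing_wedgevv a v : pairing a (wedge v v) = 0.
Proof.
rewrite pairing_wedgeE big1 // => B _; rewrite big1 // => ij _.
by rewrite mulrC [X in X - _]mulrC subrr mul0r.
Qed.

HB.instance Definition _ a w :=
  GRing.isLinear.Build R 'rV[R]_d.+1 R^o _ (wedge_form a w) (wedge_form_linear a w).

(* Two bases of a plane have proportional wedge products. *)
Lemma represents_pairing0 a c c' (U : Gr2 R d.+1) :
  represents c U -> represents c' U -> pairing a c = 0 -> pairing a c' = 0.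
Proof.
move=> [v [w [UE ->]]] [v' [w' [U'E ->]]] a0.
have spanP x : x \in <<[:: v; w]>>%VS -> exists s t, x = s *: v + t *: w.
  rewrite span_cons span_seq1 => /memv_addP[_ /vlineP[s ->] [_ /vlineP[t ->] ->]].
  by exists s, t.
have /spanP[s [t ->]] : v' \in <<[:: v; w]>>%VS.
  by rewrite -UE U'E memv_span ?mem_head.
have /spanP[s' [t' ->]] : w' \in <<[:: v; w]>>%VS.
  by rewrite -UE U'E memv_span // !inE eqxx orbT.
have pE x y z k l : pairing a (wedge (k *: x + l *: y) z) =
    k * pairing a (wedge x z) + l * pairing a (wedge y z).
  by rewrite -!/(wedge_form a z _) linearP linearZ.
rewrite pE pairing_wedgeC [in X in _ + X]pairing_wedgeC !pE !pairing_wedgevv.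
by rewrite [pairing a (wedge w v)]pairing_wedgeC a0; ring.
Qed.

Lemma big_set2_ltn (F : 'I_d.+1 * 'I_d.+1 -> R) (i j : 'I_d.+1) :
  (i < j)%N ->
  \sum_(kl : 'I_d.+1 * 'I_d.+1 | (kl.1 < kl.2)%N && ([set i; j] == [set kl.1; kl.2]))
    F kl = F (i, j).
Proof.
move=> lt_ij; rewrite (big_pred1 (i, j)) // => -[k l] /=; rewrite xpair_eqE.
apply/andP/andP=> [[lt_kl /eqP E]|[/eqP-> /eqP->]]; last by [].
have : k \in [set i; j] by rewrite E !inE eqxx.
have : l \in [set i; j] by rewrite E !inE eqxx orbT.
rewrite !inE => /orP[]/eqP le /orP[]/eqP ke; subst k l; rewrite ?eqxx //;
  by move: lt_kl lt_ij; lia.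
Qed.

Hypothesis d_gt0 : (0 < d)%N.

Lemma ext_coord_wedge_delta (i j : 'I_d.+1) (A : {set 'I_d.+1}) :
  (i < j)%N ->
  ext_coord (wedge (delta_mx 0 i) (delta_mx 0 j) : ext R d.+1 2) A =
    (A == [set i; j])%:R.
Proof.
move=> lt_ij; rewrite ext_coord_wedge; have [->|ne_A] := eqVneq A [set i; j].
  rewrite big_set2_ltn // !mxE !eqxx /= (negPf (_ : j != i)) ?mul0r ?subr0 ?mulr1 //.
  by rewrite neq_ltn lt_ij orbT.
rewrite big1 // => -[k l] /= /andP[lt_kl /eqP AE]; rewrite !mxE !eqxx /=.
have [ki|_] := eqVneq k i; have [lj|_] := eqVneq l j;
  have [li|_] := eqVneq l i; have [kj|_] := eqVneq k j;
  rewrite ?mul0r ?mulr0 ?subr0 //; move: ne_A; rewrite AE ?ki ?lj ?eqxx //.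
all: by move: lt_kl; rewrite li kj ltnNge ltnW.
Qed.

(** Up to sign, the pairing with e_i /\ e_j is the coordinate at the complement of {i, j}. *)
Lemma pairing_delta_eq0 a :
  (forall i j : 'I_d.+1, (i < j)%N ->
     pairing a (wedge (delta_mx 0 i) (delta_mx 0 j)) = 0) -> a = 0.
Proof.
move=> a0; apply/ffunP => B; rewrite ffunE.
(* Since [d - 1] is truncated, the complement has two elements only because 0 < d. *)
have [i [j [lt_ij BE]]] : exists i j : 'I_d.+1, (i < j)%N /\ ~: val B = [set i; j].
  have /cards2P[i [j [ne_ij ->]]] : #|~: val B| == 2%N.
    by move: (cardsC (val B)); rewrite (eqP (valP B)) card_ord => h; apply/eqP; lia.
  case: (ltngtP i j) => [lt|gt|/val_inj ij]; first by exists i, j.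
    by exists j, i; rewrite setUC.
  by rewrite ij eqxx in ne_ij.
have := a0 i j lt_ij; rewrite /pairing /inner (bigD1 B) //= ffunE.
rewrite ext_coord_wedge_delta // BE eqxx mulr1 big1 ?addr0 => [|B' neB].
  by move/eqP; rewrite mulf_eq0 signr_eq0 orbF => /eqP.
rewrite ffunE ext_coord_wedge_delta // -BE (inj_eq (can_inj (@setCK _))).
by rewrite (inj_eq val_inj) (negPf neB) !mulr0.
Qed.
(** Bilinearity, applied to one argument at a time: the kernel of a form that vanishes on generators
    contains their span. *)
Lemma pairing_wedge_span0 a (X Z : seq 'rV[R]_d.+1) :
  {in X & Z, forall x z, pairing a (wedge x z) = 0} ->
  {in <<X>>%VS & <<Z>>%VS, forall x z, pairing a (wedge x z) = 0}.
Proof.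
move=> XZ0; have X0 z : z \in Z -> {in <<X>>%VS, forall x, pairing a (wedge x z) = 0}.
  move=> zZ x xX; have /span_subvP/subvP/(_ _ xX) :
      {subset X <= lker (linfun (wedge_form a z))}.
    by move=> x' x'X; rewrite memv_ker lfunE /= /wedge_form XZ0.
  by rewrite memv_ker lfunE => /eqP.
move=> x z xX zZ; have /span_subvP/subvP/(_ _ zZ) :
    {subset Z <= lker (linfun (wedge_form a x))}.
  by move=> z' z'Z; rewrite memv_ker lfunE /= /wedge_form pairing_wedgeC X0 ?oppr0.
by rewrite memv_ker lfunE /= /wedge_form pairing_wedgeC oppr_eq0 => /eqP.
Qed.

(** The annihilator of all y /\ z with y in Y and z arbitrary. Letting y and z run over bases makes
    it a finite intersection of kernels, hence a subspace by construction. *)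
Definition perp Y : {vspace W} :=
  (\bigcap_(i < \dim Y) \bigcap_(j < \dim (fullv : {vspace 'rV[R]_d.+1}))
     lker (linfun (pairing_form (wedge (vbasis Y)`_i (vbasis fullv)`_j))))%VS.

Lemma perpP Y a :
  reflect (forall y z, y \in Y -> pairing a (wedge y z) = 0) (a \in perp Y).
Proof.
apply: (iffP (memv_bigcapP _ _ _)) => [a0 y z yY|a0 i _].
  move: (memvf z) yY; rewrite -(span_basis (vbasisP Y)) -(span_basis (vbasisP fullv)).
  move=> zX yX; apply: pairing_wedge_span0 yX zX.
  move=> _ _ /(nthP 0)[i + <-] /(nthP 0)[j + <-].
  rewrite !size_tuple => lt_i lt_j.
  have /memv_bigcapP/(_ (Ordinal lt_j) isT) := a0 (Ordinal lt_i) isT.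
  by rewrite memv_ker lfunE => /eqP.
apply/memv_bigcapP => j _; rewrite memv_ker lfunE /=; apply/eqP/a0.
by rewrite vbasis_mem // mem_nth // size_tuple.
Qed.

(** Extend a basis of Y to a basis X of the whole space and consider the forms given by x_k /\ x_l,
    k < l. Those with both vectors outside Y, the set [S], cut [perp Y] down to 0, which bounds its
    dimension above by |S|. The others cut the whole of [W] down to a subspace of [perp Y], which
    bounds it below by |S|. *)
Lemma dim_perp Y : \dim (perp Y) = 'C(d.+1 - \dim Y, 2).
Proof.
have dimn : \dim (fullv : {vspace 'rV[R]_d.+1}) = d.+1 by rewrite dimvf /dim /= mul1n.
have leYn : (\dim Y <= d.+1)%N by rewrite -[leqRHS]dimn dimvS ?subvf.
pose X := vbasis Y ++ vbasis (Y^C)%VS.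
have sizeX : size X = d.+1 by rewrite size_cat !size_tuple dimv_compl dimn subnKC.
have spanX : <<X>>%VS = fullv.
  by rewrite span_cat !(span_basis (vbasisP _)) addv_complf.
pose A2 : finType := {A : {set 'I_d.+1} | #|A| == 2%N}.
(* The sum has one term: it turns a 2-subset {k < l} into the form of x_k /\ x_l. *)
pose phi (A : A2) : 'Hom(W, R^o) := \sum_(kl : 'I_d.+1 * 'I_d.+1 |
  (kl.1 < kl.2)%N && (val A == [set kl.1; kl.2]))
    linfun (pairing_form (wedge X`_kl.1 X`_kl.2)).
have pairA (i j : 'I_d.+1) : (i < j)%N -> exists2 A : A2, val A = [set i; j] &
    forall a, phi A a = pairing a (wedge X`_i X`_j).
  move=> lt_ij; have A2ij : #|[set i; j]| == 2%N by rewrite cards2 neq_ltn lt_ij.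
  exists (Sub [set i; j] A2ij) => [|a]; rewrite ?SubK // /phi sum_lfunE.
  rewrite (eq_bigr (fun kl : 'I_d.+1 * 'I_d.+1 =>
    pairing a (wedge X`_kl.1 X`_kl.2))) => [|kl _].
    by rewrite SubK (big_set2_ltn _ lt_ij).
  by rewrite lfunE.
have Yle (i : 'I_d.+1) : (i < \dim Y)%N -> X`_i \in Y.
  by move=> lt_i; rewrite nth_cat size_tuple lt_i vbasis_mem // mem_nth ?size_tuple.
pose B := [set i : 'I_d.+1 | \dim Y <= i]%N.
pose S := [set A : A2 | val A \subset B].
have cardB : #|B| = (d.+1 - \dim Y)%N.
  have : #|~: B| = \dim Y.
    have wi : injective (widen_ord leYn) by move=> i j /(congr1 val) ij; apply: val_inj.
    rewrite -[RHS]card_ord -cardsT -(card_imset _ wi).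
    apply: eq_card => i; rewrite !inE -ltnNge; apply/idP/imsetP => [lt_i|[j _ ->]];
      last exact: (ltn_ord j).
    by exists (Ordinal lt_i); last exact: val_inj.
  by have := cardsC B; rewrite card_ord; lia.
have cardS : #|S| = 'C(d.+1 - \dim Y, 2).
  rewrite -cardB -cards_draws -(card_imset _ val_inj); apply: eq_card => A.
  rewrite !inE; apply/imsetP/andP => [[A' + ->]|[AB cA]].
    by rewrite inE => ->; split=> //; apply: (valP A').
  by exists (Sub A cA); rewrite ?inE SubK.
have le1 := dim_cap_bigcap_lker S phi (perp Y).
have le2 := dim_cap_bigcap_lker (~: S) phi fullv.
rewrite -cardS; apply/eqP; rewrite eqn_leq; apply/andP; split.
  apply: leq_trans le1 _; rewrite -[leqRHS]add0n leq_add2r leqn0 dimv_eq0 -subv0.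
  apply/subvP=> a; rewrite memv_cap => /andP[/perpP aY /memv_bigcapP aS].
  have a0 (i j : 'I_d.+1) : (i < j)%N -> pairing a (wedge X`_i X`_j) = 0.
    move=> lt_ij; have [lt_iY|le_Yi] := ltnP i (\dim Y); first exact/aY/Yle.
    have [A AE <-] := pairA i j lt_ij.
    suff /aS : A \in S by rewrite memv_ker => /eqP.
    rewrite inE AE; apply/subsetP=> k; rewrite !inE => /orP[]/eqP->//.
    exact: leq_trans le_Yi (ltnW lt_ij).
  rewrite memv0; apply/eqP/pairing_delta_eq0 => i j _.
  apply: (@pairing_wedge_span0 a X X); rewrite ?spanX ?memvf //.
  move=> _ _ /(nthP 0)[k + <-] /(nthP 0)[l + <-]; rewrite sizeX => lt_k lt_l.
  have [lt_kl|lt_lk|->] := ltngtP k l; last exact: pairing_wedgevv.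
    exact: (a0 (Ordinal lt_k) (Ordinal lt_l)).
  by rewrite pairing_wedgeC (a0 (Ordinal lt_l) (Ordinal lt_k)) ?oppr0.
(* Complementation matches the (d-1)-subsets with the 2-subsets, so there are as many forms as
   coordinates. *)
have cardA2 : \dim (fullv : {vspace W}) = #|{: A2}|.
  rewrite dim_fullv_ffun !card_sig.
  have dE k : #|[pred A : {set 'I_d.+1} | #|A| == k]| = 'C(d.+1, k).
    by rewrite -[in RHS](card_ord d.+1) -card_draws cardsE.
  by rewrite !dE -[in RHS](bin_sub (_ : 2 <= d.+1)%N) //; congr 'C(_, _); lia.
move: le2; rewrite cardA2 -(cardsC S) leq_add2r => /leq_trans; apply.
apply: dimvS; apply/subvP=> a; rewrite memv_cap => /andP[_ /memv_bigcapP aS].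
have a0 (i j : 'I_d.+1) : (i < j)%N -> (i < \dim Y)%N -> pairing a (wedge X`_i X`_j) = 0.
  move=> lt_ij lt_iY; have [A AE <-] := pairA i j lt_ij.
  suff /aS : A \in ~: S by rewrite memv_ker => /eqP.
  rewrite !inE AE; apply/subsetPn.
  by exists i; rewrite !inE ?eqxx // -ltnNge.
apply/perpP => y z yY; apply: (@pairing_wedge_span0 a (vbasis Y) X).
- move=> _ _ /(nthP 0)[k + <-] /(nthP 0)[l + <-]; rewrite sizeX size_tuple => lt_k lt_l.
  have -> : (vbasis Y)`_k = X`_k by rewrite nth_cat size_tuple lt_k.
  have lt_kn := leq_trans lt_k leYn.
  have [lt_kl|lt_lk|->] := ltngtP k l; last exact: pairing_wedgevv.
    exact: (a0 (Ordinal lt_kn) (Ordinal lt_l)).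
  rewrite pairing_wedgeC (a0 (Ordinal lt_l) (Ordinal lt_kn)) ?oppr0 //=.
  exact: ltn_trans lt_lk lt_k.
- by rewrite (span_basis (vbasisP _)).
- by rewrite spanX memvf.
Qed.
End Wedge.

(** * Maps that are constant on the parts of a partition *)

Section Blockwise.
Variables (K : fieldType) (wT : vectType K) (V : finType).
Implicit Types (P : {set {set V}}) (N : {set V} -> {vspace wT}).

Definition block (X : {set V}) (w : wT) : {ffun V -> wT} :=
  [ffun v => if v \in X then w else 0].

Fact block_linear X : linear (block X).
Proof.
by move=> k w w'; apply/ffunP => v; rewrite !ffunE; case: ifP; rewrite // scaler0 addr0.
Qed.

HB.instance Definition _ X :=
  GRing.isLinear.Build K wT {ffun V -> wT} _ (block X) (block_linear X).

(** Written as a sum of images to make the dimension computable; [blockwiseP] describes its elements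
    as the maps with a constant value from [N X] on each part X. *)
Definition blockwise P N := (\sum_(X in P) linfun (block X) @: N X)%VS.

Lemma block_sumE P (m : {set V} -> {ffun V -> wT}) X v :
  trivIset P -> X \in P -> v \in X ->
  (forall Y, Y \in P -> exists w, m Y = block Y w) ->
  (\sum_(Y in P) m Y) v = m X v.
Proof.
move=> tiP XP vX mP; rewrite sum_ffunE (bigD1 X) //= big1 ?addr0 // => Y /andP[YP neYX].
have [w ->] := mP Y YP; rewrite ffunE; case: ifP => // vY.
by case/eqP: neYX; rewrite -(def_pblock tiP YP vY) (def_pblock tiP XP vX).
Qed.

Lemma blockwiseP P N (m : {ffun V -> wT}) : partition P [set: V] ->
  reflect (forall X, X \in P -> exists2 w, w \in N X & {in X, forall v, m v = w})
    (m \in blockwise P N).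
Proof.
case/and3P=> /eqP covP tiP P0; apply: (iffP memv_sumP) => [[ms msP ->] X XP|mP].
  have /memv_imgP[w wN mXE] := msP X XP; exists w => // v vX.
  rewrite (block_sumE tiP XP vX) => [|Y YP]; first by rewrite mXE lfunE ffunE vX.
  by have /memv_imgP[w' _ ->] := msP Y YP; exists w'; rewrite lfunE.
exists (fun X : {set V} => [ffun v => if v \in X then m v else 0]) => [X XP|].
  have [w wN mE] := mP X XP; apply/memv_imgP; exists w => //.
  by apply/ffunP => v; rewrite lfunE !ffunE; case: ifP => // /mE.
apply/ffunP => v; have vP : v \in cover P by rewrite covP inE.
rewrite (@block_sumE _ _ (pblock P v)) ?pblock_mem ?mem_pblock ?ffunE ?mem_pblock ?vP //.
move=> Y YP; have [w _ mE] := mP Y YP; exists w.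
by apply/ffunP => u; rewrite !ffunE; case: ifP => // /mE.
Qed.

(** The summands have disjoint supports, so the sum is direct; each [block X] is injective because X
    is non-empty. *)
Lemma dim_blockwise P N : partition P [set: V] ->
  \dim (blockwise P N) = (\sum_(X in P) \dim (N X))%N.
Proof.
case/and3P=> _ tiP P0; rewrite /blockwise (directvP _) /=; last first.
  apply/directv_sum_independent => ms msP ms0 X XP.
  apply/ffunP => v; have /memv_imgP[w wN mXE] := msP X XP.
  have [vX|nvX] := boolP (v \in X); last by rewrite mXE lfunE !ffunE (negPf nvX).
  rewrite -(block_sumE tiP XP vX) ?ms0 // => Y YP.
  by have /memv_imgP[w' _ ->] := msP Y YP; exists w'; rewrite lfunE.
apply: eq_bigr => X XP; apply: limg_dim_eq; apply/eqP; rewrite -subv0.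
apply/subvP=> w; rewrite memv_cap memv_ker lfunE memv0 => /andP[_ /eqP/ffunP].
have /set0Pn[v vX] : X != set0 by apply: contraNneq P0 => <-.
by move=> /(_ v); rewrite !ffunE vX => ->.
Qed.
End Blockwise.

(** * Homogeneous coordinates, and the twists pinned at a set of points *)

Section Homogeneous.
Variables (R : realType) (d : nat) (I : finType) (p : I -> 'rV[R]_d).
Local Notation W := {ffun {A : {set 'I_d.+1} | #|A| == (d - 1)%N} -> R^o}.
Implicit Types (S : {set I}) (q x : 'rV[R]_d).

(** The vector (x, 0), that is, the point at infinity in direction x. *)
Definition at_infinity x : 'rV[R]_d.+1 := \row_i oapp (x 0) 0 (unlift ord_max i).

Fact at_infinity_linear : linear at_infinity.
Proof.
move=> k x y; apply/rowP => i; rewrite !mxE.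
by case: (unlift _ _) => [j|] /=; rewrite ?mxE // mulr0 addr0.
Qed.

HB.instance Definition _ :=
  GRing.isLinear.Build R 'rV[R]_d 'rV[R]_d.+1 _ at_infinity at_infinity_linear.

Lemma homogB q x : homog q - homog x = at_infinity (q - x).
Proof.
apply/rowP => i; rewrite !mxE.
by case: (unlift _ _) => [j|] /=; rewrite ?mxE // subrr.
Qed.

Lemma at_infinity_inj : injective at_infinity.
Proof.
move=> x y /rowP xy; apply/rowP => j; have := xy (lift ord_max j).
by rewrite !mxE liftK.
Qed.

Definition homog_span S := <<[seq homog (p r) | r <- enum S]>>%VS.

(** For r0 in S the span is the direct sum of the line of (p r0, 1) and the affine direction placed
    at infinity; the last coordinate separates the two. The empty set is set apart because its
    [aff_dim] is 0, not -1. *)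
Lemma dim_homog_span S :
  \dim (homog_span S) = if S == set0 then 0%N else (aff_dim p S).+1.
Proof.
have [->|[r0 r0S]] := set_0Vmem S.
  by rewrite eqxx /homog_span enum_set0 span_nil dimv0.
have /negPf-> : S != set0 by apply/set0Pn; exists r0.
have mem_h r : r \in S -> homog (p r) \in homog_span S.
  by move=> rS; apply/memv_span/mapP; exists r; rewrite ?mem_enum.
have h0 r : homog (p r) 0 ord_max = 1 by rewrite mxE unlift_none.
have -> : homog_span S = (<[homog (p r0)]> + linfun at_infinity @: aff_dir p S)%VS.
  apply/eqP; rewrite eqEsubv subv_add -memvE mem_h //= limg_span.
  apply/andP; split; apply/span_subvP => y /mapP[].
    move=> r + ->{y}; rewrite mem_enum => rS; rewrite -[homog _](subrK (homog (p r0))).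
    rewrite addrC memv_add ?memv_line // homogB -[at_infinity _]lfunE -limg_span.
    apply/memv_img/memv_span/allpairsP.
    by exists (r, r0); rewrite /= !mem_enum.
  move=> _ /allpairsP[[r s] /= [+ + ->]] ->{y}; rewrite !mem_enum => rS sS.
  by rewrite lfunE /= -homogB memvB ?mem_h.
rewrite dimv_disjoint_sum ?dim_vline ?limg_dim_eq //.
- suff -> : homog (p r0) != 0 by [].
  apply/eqP => /rowP/(_ ord_max)/eqP; rewrite h0 mxE; exact/negP/oner_neq0.
- apply/eqP; rewrite -subv0; apply/subvP => x; rewrite memv_cap memv0 memv_ker lfunE /=.
  by case/andP=> _ /eqP x0; apply/eqP/at_infinity_inj; rewrite x0 linear0.
apply/eqP; rewrite -subv0; apply/subvP => y; rewrite memv_cap memv0.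
case/andP=> /vlineP[k ->] /memv_imgP[x _ /rowP/(_ ord_max)]; rewrite lfunE /= mxE h0.
by rewrite mxE unlift_none mulr1 /= => ->; rewrite scale0r.
Qed.

Definition pinned S : {vspace W} := perp (homog_span S).

Lemma pinnedP S (a : W) :
  reflect (forall r q, r \in S -> pairing a (wedge (homog (p r)) (homog q)) = 0)
    (a \in pinned S).
Proof.
apply: (iffP (perpP _ _)) => [a0 r q rS|a0 y z yS].
  by apply/a0/memv_span/mapP; exists r; rewrite ?mem_enum.
(* Pins only test vectors (q, 1), but these span: z = (z', 1) + (t - 1)(0, 1), where z' is z without
   its last coordinate t. *)
have zE : z = homog (\row_j z 0 (lift ord_max j)) + (z 0 ord_max - 1) *: homog 0.
  apply/rowP => i; rewrite !mxE; case: unliftP => [j ->|->] /=; rewrite ?mxE.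
    by rewrite mulr0 addr0.
  by rewrite mulr1 addrC subrK.
pose Z := [:: homog (\row_j z 0 (lift ord_max j)); homog (0 : 'rV[R]_d)].
have zZ : z \in <<Z>>%VS.
  by rewrite {1}zE memvD ?memvZ // memv_span // !inE eqxx ?orbT.
apply: pairing_wedge_span0 yS zZ => y' z' /mapP[r + ->{y'}].
by rewrite mem_enum => rS; rewrite !inE => /orP[]/eqP->; apply: a0.
Qed.

End Homogeneous.

(** By Pascal's rule the term i = k + 1, which is d - k, equals C(d + 1 - k, 2) - C(d - k, 2), so
    the sum telescopes. It is the codimension of the twists pinned at points spanning an affine
    space of dimension k - 1. *)
Lemma sum_arith_bin (d k : nat) : (k <= d.+1)%N ->
  \sum_(1 <= i < k.+1) (d%:Z - i%:Z + 1) = 'C(d.+1, 2)%:Z - 'C(d.+1 - k, 2)%:Z.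
Proof.
elim: k => [|k IHk] lek; first by rewrite big_geq // subn0 subrr.
rewrite big_nat_recr //= IHk 1?ltnW //.
have -> : (d.+1 - k = (d.+1 - k.+1).+1)%N by lia.
rewrite [X in _ - X%:Z + _]binS bin1 PoszD.
lia.
Qed.

(** * Pinned body-bar frameworks: the dimension count, necessity and sufficiency *)

Section Frameworks.
Variables (R : realType) (d : nat) (V E I : finType).
Variables (ends : E -> V * V) (rt : I -> V) (p : I -> 'rV[R]_d).
Local Notation W := {ffun {A : {set 'I_d.+1} | #|A| == (d - 1)%N} -> R^o}.
Implicit Types (P : {set {set V}}) (m : {ffun V -> W}).

Definition edge_form e (c : ext R d.+1 2) m : R^o :=
  pairing_form c (m (ends e).1 - m (ends e).2).

Fact edge_form_linear e c : linear (edge_form e c).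
Proof.
move=> k m m'; rewrite /edge_form -linearP; congr pairing_form.
by rewrite !ffunE scalerBr opprD addrACA.
Qed.

HB.instance Definition _ e c := GRing.isLinear.Build R {ffun V -> W} R^o _
  (edge_form e c) (edge_form_linear e c).

Definition bar_space e c : {vspace {ffun V -> W}} := lker (linfun (edge_form e c)).

Lemma bar_spaceP e c m :
  reflect (pairing (m (ends e).1 - m (ends e).2) c = 0) (m \in bar_space e c).
Proof. by rewrite memv_ker lfunE; apply: eqP. Qed.

Definition vertex_value v m : W := m v.

Fact vertex_value_linear v : linear (vertex_value v).
Proof. by move=> k m m'; rewrite /vertex_value !ffunE. Qed.

HB.instance Definition _ v := GRing.isLinear.Build R {ffun V -> W} W _
  (vertex_value v) (vertex_value_linear v).

Definition pin_space : {vspace {ffun V -> W}} :=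
  (\bigcap_v linfun (vertex_value v) @^-1: pinned p (roots_in rt [set v]))%VS.

Lemma pin_spaceP m :
  reflect (forall v r, rt r = v -> forall q,
             pairing (m v) (wedge (homog (p r)) (homog q)) = 0)
    (m \in pin_space).
Proof.
apply: (iffP (memv_bigcapP _ _ _)) => [h v r rv q|h v _].
  have := h v isT; rewrite -memv_preim lfunE => /pinnedP; apply.
  by rewrite !inE rv.
by rewrite -memv_preim lfunE; apply/pinnedP => r q; rewrite !inE => /eqP/h; apply.
Qed.

(** Each part moves as a single body, pinned at the points of all its roots. *)
Definition rigid_parts P : {vspace {ffun V -> W}} :=
  blockwise P (fun X => pinned p (roots_in rt X)).

Lemma rigid_parts_pin P m : partition P [set: V] ->
  m \in rigid_parts P ->
  m \in pin_space /\
  forall e, e \notin crossing_edges ends P -> m (ends e).1 = m (ends e).2.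
Proof.
move=> partP /(blockwiseP _ _ partP) mP; have [/eqP covP tiP P0] := and3P partP.
have mE v : exists2 w, w \in pinned p (roots_in rt (pblock P v)) &
    {in pblock P v, forall u, m u = w}.
  by apply: mP; rewrite pblock_mem // covP inE.
have inP v : v \in pblock P v by rewrite mem_pblock covP inE.
split.
  apply/pin_spaceP => v r rv q; have [w /pinnedP wN mw] := mE v.
  by rewrite mw // wN // inE rv.
move=> e; rewrite inE negbK => /eqP ee; have [w _ mw] := mE (ends e).1.
by rewrite !mw // ee.
Qed.

Lemma mem_rigid_parts P m : partition P [set: V] -> m \in pin_space ->
  (forall X u v, X \in P -> u \in X -> v \in X -> m u = m v) -> m \in rigid_parts P.
Proof.
move=> partP /pin_spaceP mp mP; have [_ _ P0] := and3P partP.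
apply/(blockwiseP _ _ partP) => X XP.
have /set0Pn[v vX] : X != set0 by apply: contraNneq P0 => <-.
exists (m v) => [|u uX]; last exact: mP XP uX vX.
apply/pinnedP => r q; rewrite inE => rX.
by rewrite (mP X v (rt r)) // (mp _ r).
Qed.

Hypothesis d_gt0 : (0 < d)%N.

Lemma dim_rigid_parts P : partition P [set: V] ->
  (\dim (rigid_parts P))%:Z = 'C(d.+1, 2)%:Z * #|P|%:Z -
    \sum_(X in P | roots_in rt X != set0)
      \sum_(1 <= i < (aff_dim p (roots_in rt X)).+2) (d%:Z - i%:Z + 1) :> int.
Proof.
move=> partP; rewrite dim_blockwise // big_mkcondr /=.
have -> : 'C(d.+1, 2)%:Z * #|P|%:Z = \sum_(X in P) 'C(d.+1, 2)%:Z.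
  by rewrite sumr_const -mulr_natr natz.
rewrite -sumrB (big_morph Posz PoszD (erefl _)); apply: eq_bigr => X _.
(* A part without roots contributes the full C(d + 1, 2). *)
rewrite dim_perp // dim_homog_span; case: (_ == _) => /=; first by rewrite subn0 subr0.
rewrite sum_arith_bin; first by rewrite opprB addrC subrK.
rewrite ltnS; apply: leq_trans (dimvS (subvf _)) _.
by rewrite dimvf /dim /= mul1n.
Qed.

(** A map in [rigid_parts P] that satisfies the equations of the crossing bars is a motion, hence
    zero; so there are at least as many crossing edges as dimensions. *)
Lemma rigid_necessity (b : E -> Gr2 R d.+1) P :
  inf_rigid ends rt b p -> partition P [set: V] ->
  (\dim (rigid_parts P) <= #|crossing_edges ends P|)%N.
Proof.
move=> rig partP.
have /fin_all_exists[c cb] e : exists c, represents c (b e).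
  have := vbasisP (val (b e)); case: (vbasis _) => s /= ss.
  move: ss; rewrite (eqP (valP (b e))); case: s => [|v [|w []]] // _ /span_basis vw.
  by exists (wedge v w), v, w.
have := dim_cap_bigcap_lker (crossing_edges ends P)
  (fun e => linfun (edge_form e (c e))) (rigid_parts P).
move/leq_trans; apply; rewrite -[leqRHS]add0n leq_add2r leqn0 dimv_eq0 -subv0.
apply/subvP => m; rewrite memv_cap => /andP[mP /memv_bigcapP mc].
rewrite memv0; apply/eqP/ffunP => v; rewrite ffunE.
have [/pin_spaceP mpin mE] := rigid_parts_pin partP mP.
apply: rig; split=> // e c' c'b.
(* On a crossing edge the equation for the chosen representative implies it for every other; on any
   other edge [m] agrees at both ends. *)
have [/mc/bar_spaceP|/mE->] := boolP (e \in crossing_edges ends P).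
  exact: represents_pairing0 (cb e) c'b.
by rewrite subrr -[LHS]/(pairing_form c' 0) linear0.
Qed.

(** The connected components of the graph (V, J). *)
Definition component_partition (J : {set E}) : {set {set V}} :=
  equivalence_partition
    (connect [rel u v | [exists e in J, (ends e == (u, v)) || (ends e == (v, u))]])
    [set: V].

Lemma component_partitionP (J : {set E}) :
  [/\ partition (component_partition J) [set: V],
      crossing_edges ends (component_partition J) \subset ~: J &
      forall m : {ffun V -> W},
        {in J, forall e, m (ends e).1 = m (ends e).2} ->
        forall X u v, X \in component_partition J -> u \in X -> v \in X -> m u = m v].
Proof.
rewrite /component_partition; set adj := (X in connect X).
have csym : connect_sym adj.
  by apply: sym_connect_sym => u v /=; apply: eq_existsb => e; rewrite orbC.
have eqR : {in [set: V] & &, equivalence_rel (connect adj)}.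
  move=> x y z _ _ _; split; first exact: connect0.
  by move=> cxy; apply: same_connect.
have partP := equivalence_partitionP eqR; have [/eqP covP tiP P0] := and3P partP.
have pbE u v : (v \in pblock (equivalence_partition (connect adj) [set: V]) u) =
    connect adj u v by rewrite pblock_equivalence_partition ?inE.
split=> // [|m mJ X u v XP uX vX].
  apply/subsetP => e; rewrite !inE; apply: contra => eJ.
  rewrite eq_pblock // ?covP ?inE // pbE; apply: connect1.
  by apply/existsP; exists e; rewrite eJ -surjective_pairing eqxx.
move: vX; rewrite -(def_pblock tiP XP uX) pbE => /connectP[s + ->].
elim: s u {uX} => //= w s IHs u /andP[/existsP[e /andP[/mJ me ue]] /IHs <-].
by move: me; case/orP: ue => /eqP->.
Qed.

Lemma rigid_sufficiency :
  (forall P, partition P [set: V] ->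
     (\dim (rigid_parts P) <= #|crossing_edges ends P|)%N) ->
  exists b : E -> Gr2 R d.+1, inf_rigid ends rt b p.
Proof.
move=> condP; pose w (ij : 'I_d.+1 * 'I_d.+1) : ext R d.+1 2 :=
  wedge (delta_mx 0 ij.1) (delta_mx 0 ij.2).
pose T (e : E) := [set ij : 'I_d.+1 * 'I_d.+1 | (ij.1 < ij.2)%N].
have [||f [fT f0]] := @rado_spanning_transversal _ _ _ _
  (fun e ij => bar_space e (w ij)) pin_space T.
(* The pair (0, d) is increasing because 0 < d. *)
- move=> e; apply/set0Pn; exists (ord0, ord_max); by rewrite inE.
(* All coordinate bars on an edge force equal values at its ends. Imposed on J, they leave only maps
   constant on the components, whose dimension is at most the number of crossing edges, all outside
   J. *)
- move=> J; have [partP subJ mP] := component_partitionP J.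
  apply: leq_trans (subset_leq_card subJ); apply: leq_trans (condP _ partP).
  apply: dimvS; apply/subvP => m; rewrite memv_cap => /andP[mpin /memv_bigcapP mJ].
  apply: mem_rigid_parts => //; apply: mP => e eJ; apply/eqP; rewrite -subr_eq0.
  apply/eqP/(pairing_delta_eq0 d_gt0) => i j lt_ij.
  have /memv_bigcapP/(_ (i, j)) := mJ e eJ.
  by rewrite inE => /(_ lt_ij)/bar_spaceP.
(* The selected bar of [e] is the coordinate plane spanned by e_i and e_j. *)
have /fin_all_exists[b bw] e : exists U : Gr2 R d.+1, represents (w (f e)) U.
  have := fT e; rewrite inE; case: (f e) => i j /= lt_ij.
  have dim2 : \dim <<[:: delta_mx 0 i; delta_mx 0 j : 'rV[R]_d.+1]>> == 2%N.
    rewrite -[2%N]/(size [:: delta_mx 0 i; delta_mx 0 j : 'rV[R]_d.+1]).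
    change (free [:: delta_mx 0 i; delta_mx 0 j : 'rV[R]_d.+1]).
    rewrite free_cons span_seq1 seq1_free; apply/andP; split.
      apply/vlineP => -[k /rowP/(_ i)]; rewrite !mxE !eqxx (negPf (_ : i != j)).
        by rewrite mulr0 => /eqP; rewrite oner_eq0.
      by rewrite neq_ltn lt_ij.
    by apply/eqP => /rowP/(_ j)/eqP; rewrite !mxE !eqxx oner_eq0.
  pose U : Gr2 R d.+1 := exist (fun U : {vspace _} => \dim U == 2%N) _ dim2.
  by exists U, (delta_mx 0 i), (delta_mx 0 j).
exists b => m [mb mpin] v; pose m' : {ffun V -> W} := [ffun v => m v].
suff : m' \in (pin_space :&: \bigcap_e bar_space e (w (f e)))%VS.
  by rewrite f0 memv0 => /eqP/ffunP/(_ v); rewrite !ffunE.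
rewrite memv_cap; apply/andP; split.
  by apply/pin_spaceP => u r ru q; rewrite ffunE (mpin u r).
by apply/memv_bigcapP => e _; apply/bar_spaceP; rewrite !ffunE mb.
Qed.

End Frameworks.

Theorem theorem6p3 (R : realType) (d : nat) (hd : (0 < d)%N)
    (V E I : finType) (ends : E -> V * V) (rt : I -> V)
    (p : I -> 'rV[R]_d) :
  (exists b : E -> Gr2 R d.+1, inf_rigid ends rt b p) <->
  (forall P : {set {set V}}, partition P [set: V] ->
     (#|crossing_edges ends P|%:Z >=
        'C(d.+1, 2)%:Z * #|P|%:Z -
        \sum_(X in P | roots_in rt X != set0)
          \sum_(1 <= i < (aff_dim p (roots_in rt X)).+2)
             (d%:Z - i%:Z + 1) :> int)).
Proof.
split=> [[b rig] P partP|condP].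
  by rewrite -dim_rigid_parts // lez_nat; apply: rigid_necessity rig partP.
by apply: rigid_sufficiency => // P partP; rewrite -lez_nat dim_rigid_parts // condP.
Qed.
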